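(* If $n\ne 1$ is a positive integer and $a\in\mathbf{F}_n(\mathbb{Z})$ is of periodicity $n$, then $\langle a\rangle=\mathbf{F}_n(\mathbb{Z})$, i.e., the subalgebra of $\mathbf{F}_n(\mathbb{Z})$ generated by $a$ is all of $\mathbf{F}_n(\mathbb{Z})$.
   Context: $\mathbf{F}(\mathbb{Z})$ is the algebra $(F(\mathbb{Z}),\wedge,\vee,\circ,\mathrm{id},{}^\ell,{}^r)$ of all order-preserving maps $f\colon\mathbb{Z}\to\mathbb{Z}$ such that $f^{-1}[\{x\}]$ is finite for every $x\in\mathbb{Z}$, with composition, the identity map, pointwise lattice operations, and $f^{\ell}(q)=\min\{p: q\le f(p)\}$, $f^{r}(q)=\max\{p: f(p)\le q\}$ (it is an $\ell$-pregroup). Write $f^{\ell^k}$, $f^{r^k}$ for the $k$-fold application of ${}^\ell$, ${}^r$. An element $f$ is $k$-periodic if $f^{\ell^k}=f^{r^k}$; equivalently, $f(x+k)=f(x)+k$ for all $x\in\mathbb{Z}$. $\mathbf{F}_n(\mathbb{Z})$ is the subalgebra of all $n$-periodic elements of $\mathbf{F}(\mathbb{Z})$. The periodicity of $f$ is the least $k\ge 1$ such that $f$ is $k$-periodic. $\langle X\rangle$ denotes the subalgebra generated by $X$ in the signature $(\wedge,\vee,\cdot,1,{}^\ell,{}^r)$. *)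

(* Defs.v *)
From mathcomp Require Import all_boot all_order all_algebra.
From mathcomp Require Import boolp classical_sets functions cardinality.
From mathcomp Require Import zify.

Set Implicit Arguments.
Unset Strict Implicit.
Unset Printing Implicit Defensive.

Import Order.TTheory GRing.Theory Num.Theory.

Local Open Scope classical_set_scope.
Local Open Scope ring_scope.

Definition is_FZ (f : int -> int) : Prop :=
  {homo f : x y / x <= y} /\ forall x, finite_set (f @^-1` [set x]).

Record FZ := MkFZ { FZ_fun :> int -> int; FZ_is_FZ : is_FZ FZ_fun }.

Lemma FZ_eqP (f g : FZ) : f =1 g <-> f = g.
Proof.
split=> [|-> //]; case: f g => [f Hf] [g Hg] /= /funext fg.
by case: _ / fg in Hg *; congr MkFZ; exact: Prop_irrelevance.
Qed.

(* The default value 0 is used only when the least (greatest) element does not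
   exist; by res_l_spec and res_r_spec this never happens below. *)
Definition set_min (A : set int) : int := xget 0 (A `&` lbound A).
Definition set_max (A : set int) : int := xget 0 (A `&` ubound A).

Definition res_l (f : int -> int) (q : int) : int := set_min [set p | q <= f p].
Definition res_r (f : int -> int) (q : int) : int := set_max [set p | f p <= q].

Lemma finite_int_itv (a b : int) : finite_set [set x : int | a <= x <= b].
Proof.
apply: (@sub_finite_set _ _ [set` [seq a + n%:Z | n <- iota 0 `|b - a|.+1]]);
  last exact: finite_seq.
move=> x /andP[ax xb]; apply/mapP; exists `|x - a|%N; last by lia.
by rewrite mem_iota; lia.
Qed.

Lemma infinite_ge0 : ~ finite_set [set x : int | 0 <= x].
Proof.
move=> /(finite_image absz) fin; apply: infinite_nat.
by apply: sub_finite_set fin => n _ /=; exists n%:Z.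
Qed.

Lemma infinite_le0 : ~ finite_set [set x : int | x <= 0].
Proof.
move=> /(finite_image absz) fin; apply: infinite_nat.
by apply: sub_finite_set fin => n _ /=; exists (- n%:Z); lia.
Qed.

Lemma FZ_unbounded_above (f : int -> int) (q : int) :
  is_FZ f -> exists p, q <= f p.
Proof.
move=> [mono fin]; apply: contrapT => noP; apply: infinite_ge0.
apply: (@sub_finite_set _ _
  (\bigcup_(y in [set y | f 0 <= y <= q]) (f @^-1` [set y]))); last first.
  by apply: bigcup_finite => [|y _]; [exact: finite_int_itv | exact: fin].
move=> p /= p0; exists (f p) => //=; rewrite mono //=.
by case: (leP (f p) q) => // /ltW qf; case: noP; exists p.
Qed.

Lemma FZ_unbounded_below (f : int -> int) (q : int) :
  is_FZ f -> exists p, f p <= q.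
Proof.
move=> [mono fin]; apply: contrapT => noP; apply: infinite_le0.
apply: (@sub_finite_set _ _
  (\bigcup_(y in [set y | q <= y <= f 0]) (f @^-1` [set y]))); last first.
  by apply: bigcup_finite => [|y _]; [exact: finite_int_itv | exact: fin].
move=> p /= p0; exists (f p) => //=; rewrite (mono _ _ p0) andbT.
by case: (leP q (f p)) => // /ltW qf; case: noP; exists p.
Qed.

Lemma res_l_spec (f : int -> int) (q : int) : is_FZ f ->
  ([set p | q <= f p] `&` lbound [set p | q <= f p]) (res_l f q).
Proof.
move=> Ff; apply: xgetPex; have [mono _] := Ff.
have [u qu] := FZ_unbounded_above q Ff.
have [l lq] := FZ_unbounded_below (q - 1) Ff.
have below p : q <= f p -> l <= p.
  by move=> qp; case: (leP l p) => // /ltW /mono; lia.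
have exk : exists k : nat, q <= f (l + k%:Z).
  by exists `|u - l|%N; have := below u qu; move=> lu;
    have -> : l + `|u - l|%N%:Z = u by lia.
case: (ex_minnP exk) => m qm min_m; exists (l + m%:Z); split=> // p /= qp.
have lp := below p qp; have := min_m `|p - l|%N.
have -> : l + `|p - l|%N%:Z = p by lia.
by move=> /(_ qp); lia.
Qed.

Lemma res_r_spec (f : int -> int) (q : int) : is_FZ f ->
  ([set p | f p <= q] `&` ubound [set p | f p <= q]) (res_r f q).
Proof.
move=> Ff; apply: xgetPex; have [mono _] := Ff.
have [l lq] := FZ_unbounded_below q Ff.
have [u qu] := FZ_unbounded_above (q + 1) Ff.
have above p : f p <= q -> p <= u.
  by move=> qp; case: (leP p u) => // /ltW /mono; lia.
have exk : exists k : nat, f (u - k%:Z) <= q.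
  by exists `|u - l|%N; have := above l lq; move=> lu;
    have -> : u - `|u - l|%N%:Z = l by lia.
case: (ex_minnP exk) => m qm min_m; exists (u - m%:Z); split=> // p /= qp.
have lp := above p qp; have := min_m `|u - p|%N.
have -> : u - `|u - p|%N%:Z = p by lia.
by move=> /(_ qp); lia.
Qed.

Lemma is_FZ_id : is_FZ id.
Proof. by split=> // x; exact: finite_set1. Qed.

Lemma is_FZ_comp (f g : int -> int) : is_FZ f -> is_FZ g -> is_FZ (f \o g).
Proof.
move=> [mf ff] [mg fg]; split=> [x y /mg /mf //|x].
apply: (@sub_finite_set _ _
  (\bigcup_(y in f @^-1` [set x]) (g @^-1` [set y]))); last first.
  by apply: bigcup_finite => [|y _]; [exact: ff | exact: fg].
by move=> p /= fgp; exists (g p).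
Qed.

Lemma is_FZ_min (f g : int -> int) : is_FZ f -> is_FZ g -> is_FZ (f \min g).
Proof.
move=> [mf ff] [mg fg]; split=> [x y xy /=|x].
  by have := mf _ _ xy; have := mg _ _ xy; lia.
apply: (@sub_finite_set _ _ (f @^-1` [set x] `|` g @^-1` [set x])).
  by move=> p /=; case: leP => _ <-; [left | right].
by rewrite finite_setU; split.
Qed.

Lemma is_FZ_max (f g : int -> int) : is_FZ f -> is_FZ g -> is_FZ (f \max g).
Proof.
move=> [mf ff] [mg fg]; split=> [x y xy /=|x].
  by have := mf _ _ xy; have := mg _ _ xy; lia.
apply: (@sub_finite_set _ _ (f @^-1` [set x] `|` g @^-1` [set x])).
  by move=> p /=; case: leP => _ <-; [right | left].
by rewrite finite_setU; split.
Qed.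

Lemma is_FZ_res_l (f : int -> int) : is_FZ f -> is_FZ (res_l f).
Proof.
move=> Ff; split=> [x y xy|x].
  have [_ minx] := res_l_spec x Ff; have [/= fy _] := res_l_spec y Ff.
  by apply: minx => /=; exact: le_trans fy.
apply: sub_finite_set (finite_int_itv (f (x - 1)) (f x)) => q /= qx.
have [/= fq minq] := res_l_spec q Ff; rewrite qx in fq minq.
rewrite fq andbT; case: (leP (f (x - 1)) q) => // /ltW /(minq (x - 1)).
by lia.
Qed.

Lemma is_FZ_res_r (f : int -> int) : is_FZ f -> is_FZ (res_r f).
Proof.
move=> Ff; split=> [x y xy|x].
  have [/= fx _] := res_r_spec x Ff; have [_ maxy] := res_r_spec y Ff.
  by apply: maxy => /=; exact: le_trans xy.
apply: sub_finite_set (finite_int_itv (f x) (f (x + 1))) => q /= qx.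
have [/= fq maxq] := res_r_spec q Ff; rewrite qx in fq maxq.
rewrite fq /=; case: (leP q (f (x + 1))) => // /ltW /(maxq (x + 1)).
by lia.
Qed.

Definition FZ_id : FZ := MkFZ is_FZ_id.
Definition FZ_comp (f g : FZ) : FZ :=
  MkFZ (is_FZ_comp (FZ_is_FZ f) (FZ_is_FZ g)).
Definition FZ_meet (f g : FZ) : FZ :=
  MkFZ (is_FZ_min (FZ_is_FZ f) (FZ_is_FZ g)).
Definition FZ_join (f g : FZ) : FZ :=
  MkFZ (is_FZ_max (FZ_is_FZ f) (FZ_is_FZ g)).
Definition FZ_l (f : FZ) : FZ := MkFZ (is_FZ_res_l (FZ_is_FZ f)).
Definition FZ_r (f : FZ) : FZ := MkFZ (is_FZ_res_r (FZ_is_FZ f)).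

Definition periodic (k : nat) (f : FZ) : Prop := iter k FZ_l f = iter k FZ_r f.

Definition FnZ (n : nat) : set FZ := [set f | periodic n f].

Definition has_periodicity (f : FZ) (k : nat) : Prop :=
  [/\ (1 <= k)%N, periodic k f &
      forall j, (1 <= j)%N -> periodic j f -> (k <= j)%N].

Definition is_subalgebra (S : set FZ) : Prop :=
  S FZ_id /\
  (forall f g, S f -> S g -> [/\ S (FZ_meet f g), S (FZ_join f g) &
                                 S (FZ_comp f g)]) /\
  (forall f, S f -> S (FZ_l f) /\ S (FZ_r f)).

Definition generated (X : set FZ) : set FZ := smallest is_subalgebra X.

(* Main.v *)
Require Import Defs.
From mathcomp Require Import all_boot all_order all_algebra.
From mathcomp Require Import boolp classical_sets functions cardinality.
From mathcomp Require Import zify.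

(** Write S for the subalgebra generated by a.  Since f^ll is the conjugate of f
    by the successor map, S is stable under conjugation by every translation,
    and k-periodicity of f is the equation f(x + k) = f(x) + k.

    Among the elements h of S with h <= id and h(0) = 0 there is a least one, m
    ([least_deflation]); being least, it is idempotent, so its image is its set
    of fixed points.  Let d be the least positive fixed point; d <= n because n
    is fixed.  For any x let f be a composed with the conjugate of m that fixes
    x.  Then f f^r <= id, f f^r fixes a(x), and its conjugate by
    the translation by a(x) competes with m, hence fixes d.  So a(x) + d is a
    value of f, that is, a(x) + d = a(x + p) for a fixed point p > 0 of m.  As
    d <= p, this gives a(x + d) <= a(x) + d for every x; the n-periodicity of a
    turns the inequality into an equality, and minimality of n forces d = n.
    Therefore m vanishes on [0, n) ([has_block_of_aperiodic]): it sends z to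
    the greatest multiple of n that is at most z.

    From this one step function, conjugation, composition and ^l produce the
    step functions with every value u on every interval [x, x + n)
    ([has_block_all]); n <> 1 enters here, since for n = 1 the step function
    found so far is id, which generates only itself.  The step function with value
    f(x) on [x, x + n) is the least n-periodic monotone map with value at least
    f(x) at x, so every f in F_n(Z) is the join of its n step functions
    ([equivariant_in_alg]). *)

Import Order.TTheory GRing.Theory Num.Theory.

Local Open Scope ring_scope.
Local Open Scope classical_set_scope.

(** * Residuals, translations and periodicity *)

Definition equivariant (k : int) (f : int -> int) : Prop :=
  forall x, f (x + k) = f x + k.

Lemma FZ_mono (f : FZ) (x y : int) : x <= y -> f x <= f y.
Proof. by case: f => f [mono fin] /=; exact: mono. Qed.

Lemma FZ_l_le (f : FZ) (p q : int) : (FZ_l f q <= p) = (q <= f p).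
Proof.
have [/= qf least] := res_l_spec q (FZ_is_FZ f).
apply/idP/idP => [/(FZ_mono f)|/least //].
exact: le_trans.
Qed.

Lemma FZ_r_ge (f : FZ) (p q : int) : (p <= FZ_r f q) = (f p <= q).
Proof.
have [/= fq greatest] := res_r_spec q (FZ_is_FZ f).
apply/idP/idP => [/(FZ_mono f) fp|/greatest //].
exact: le_trans fq.
Qed.

Lemma FZ_lK : cancel FZ_l FZ_r.
Proof.
move=> f; apply/FZ_eqP => q; apply/eqP; rewrite eq_le.
by rewrite -FZ_l_le -FZ_r_ge lexx FZ_r_ge FZ_l_le lexx.
Qed.

Lemma FZ_rK : cancel FZ_r FZ_l.
Proof.
move=> f; apply/FZ_eqP => q; apply/eqP; rewrite eq_le.
by rewrite FZ_l_le FZ_r_ge lexx -FZ_r_ge -FZ_l_le lexx.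
Qed.

(** Negating the adjunction twice: q <= f^l(p) fails iff f^l(p) <= q - 1, which
    says p <= f(q - 1). *)
Lemma FZ_llE (f : FZ) (q : int) : FZ_l (FZ_l f) q = f (q - 1) + 1.
Proof.
have H p : (FZ_l (FZ_l f) q <= p) = (f (q - 1) + 1 <= p).
  rewrite FZ_l_le; have := FZ_l_le f (q - 1) p; lia.
by apply/eqP; rewrite eq_le H lexx -H lexx.
Qed.

Lemma FZ_rrE (f : FZ) (q : int) : FZ_r (FZ_r f) q = f (q + 1) - 1.
Proof. by rewrite -{2}(FZ_rK f) -{2}(FZ_rK (FZ_r f)) FZ_llE !addrK. Qed.

Lemma iter_FZ_ll (f : FZ) (k : nat) (q : int) :
  iter k (FZ_l \o FZ_l) f q = f (q - k%:Z) + k%:Z.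
Proof.
elim: k q => [|k IH] q /=; first by rewrite subr0 addr0.
rewrite -[LHS]/(FZ_l (FZ_l _) q) FZ_llE IH.
have -> : q - 1 - k%:Z = q - k.+1%:Z by lia.
lia.
Qed.

(** As ^l and ^r are mutually inverse, f^(l^k) = f^(r^k) means f^(l^2k) = f, and
    l^2k is conjugation by the translation by k. *)
Lemma periodicP (k : nat) (f : FZ) : periodic k f <-> equivariant k%:Z f.
Proof.
have iterK (u v : FZ -> FZ) : cancel u v -> forall j, cancel (iter j u) (iter j v).
  by move=> uvK; elim=> [//|j IH] g; rewrite [LHS]iterSr iterS uvK IH.
have ll : iter k FZ_l (iter k FZ_l f) = iter k (FZ_l \o FZ_l) f.
  elim: k => [//|j IH]; rewrite [RHS]iterS -IH /=; congr (FZ_l _).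
  by rewrite -iterSr.
have -> : periodic k f <-> iter k (FZ_l \o FZ_l) f = f.
  rewrite -ll /periodic; split=> [->|lf]; first by rewrite (iterK _ _ FZ_rK k).
  by rewrite -[RHS](congr1 (iter k FZ_r) lf) (iterK _ _ FZ_lK k).
rewrite -FZ_eqP; split=> [fk x|fk x].
  by rewrite -fk iter_FZ_ll addrK.
by rewrite iter_FZ_ll -fk subrK.
Qed.

Lemma equivariantMz (k : int) (f : FZ) (q x : int) :
  equivariant k f -> f (x + q * k) = f x + q * k.
Proof.
move=> fk; have pos j y : f (y + j%:Z * k) = f y + j%:Z * k.
  elim: j y => [|j IH] y; first by rewrite mul0r !addr0.
  by rewrite -addn1 PoszD mulrDl mul1r !addrA fk IH.
case: q => j; first exact: pos.
by rewrite NegzE mulNr; apply/eqP; rewrite eq_sym subr_eq -pos subrK.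
Qed.

Lemma equivariant_le (n : nat) (f g : FZ) (x : int) : (0 < n)%N ->
  equivariant n%:Z f -> equivariant n%:Z g ->
  (forall z, x <= z < x + n%:Z -> f z <= g z) -> forall z, f z <= g z.
Proof.
move=> n0 fn gn fg z.
have := divz_eq (z - x) n%:Z; have := modz_ge0 (z - x) (_ : n%:Z != 0).
have := ltz_pmod (z - x) (_ : 0 < n%:Z).
set q := ((z - x) %/ n%:Z)%Z; set r := ((z - x) %% n%:Z)%Z => rn r0 zE.
have -> : z = x + r + q * n%:Z by lia.
rewrite !equivariantMz // lerD2r; apply: fg.
by move: (r0 ltac:(lia)) (rn ltac:(lia)); lia.
Qed.

(** * Subalgebras of n-periodic maps *)

Lemma FnZ_subalgebra (n : nat) : is_subalgebra (FnZ n).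
Proof.
split; first by apply/periodicP.
split=> [f g /periodicP fn /periodicP gn|f fn].
  split; apply/periodicP => x /=; rewrite ?gn ?fn //; lia.
(* Mutually inverse maps commute, so ^l and ^r preserve f^(l^n) = f^(r^n). *)
have swap (u v : FZ -> FZ) : cancel u v -> cancel v u ->
    forall j g, iter j u (v g) = v (iter j u g).
  by move=> uK vK; elim=> //= j IH g; rewrite IH vK uK.
split; rewrite /FnZ /= /periodic.
  by rewrite (swap _ _ FZ_rK FZ_lK) -fn -iterSr.
by rewrite (swap _ _ FZ_lK FZ_rK) fn -iterSr.
Qed.

Section Subalgebra.
Variable S : set FZ.
Hypothesis algS : is_subalgebra S.

Lemma alg_id : S FZ_id. Proof. by case: algS. Qed.

Lemma alg_meet (f g : FZ) : S f -> S g -> S (FZ_meet f g).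
Proof. by case: algS => _ [op _] Sf Sg; case: (op f g Sf Sg). Qed.

Lemma alg_join (f g : FZ) : S f -> S g -> S (FZ_join f g).
Proof. by case: algS => _ [op _] Sf Sg; case: (op f g Sf Sg). Qed.

Lemma alg_comp (f g : FZ) : S f -> S g -> S (FZ_comp f g).
Proof. by case: algS => _ [op _] Sf Sg; case: (op f g Sf Sg). Qed.

Lemma alg_l (f : FZ) : S f -> S (FZ_l f).
Proof. by case: algS => _ [_ op] /op[]. Qed.

Lemma alg_r (f : FZ) : S f -> S (FZ_r f).
Proof. by case: algS => _ [_ op] /op[]. Qed.

Lemma alg_shift (f : FZ) (k : int) : S f ->
  exists2 g, S g & forall z, g z = f (z - k) + k.
Proof.
move=> Sf; case: k => k.
  exists (iter k (FZ_l \o FZ_l) f) => [|z]; last exact: iter_FZ_ll.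
  by elim: k => //= k IH; do 2!apply: alg_l.
elim: k => [|k [g Sg gE]].
  exists (FZ_r (FZ_r f)) => [|z]; first by do 2!apply: alg_r.
  by rewrite FZ_rrE NegzE opprK.
exists (FZ_r (FZ_r g)) => [|z]; first by do 2!apply: alg_r.
rewrite FZ_rrE gE.
have -> : z + 1 - Negz k = z - Negz k.+1 by lia.
lia.
Qed.

Variable n : nat.
Hypothesis n_gt0 : (0 < n)%N.
Hypothesis Sn : forall f, S f -> equivariant n%:Z f.

(** * The least deflation *)

Definition deflation (h : FZ) : Prop := (forall z, h z <= z) /\ h 0 = 0.

(** A deflation is nonnegative at each i in [0, n), so some deflation in S has the
    least value there; the meet of these n maps is least on a whole period. *)
Lemma least_deflation :
  exists m, [/\ S m, deflation m &
    forall h, S h -> deflation h -> forall z, m z <= h z].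
Proof.
have [m [Sm dm lem]] : exists m, [/\ S m, deflation m &
    forall h, S h -> deflation h ->
      forall i : nat, (i < n)%N -> m i%:Z <= h i%:Z].
  elim: n => [|k [m [Sm [m_le m0] lem]]].
    by exists FZ_id; split=> //; exact: alg_id.
  pose attained (v : nat) := `[< exists h, [/\ S h, deflation h & h k%:Z = v] >].
  have ge0 (h : FZ) : deflation h -> 0 <= h k%:Z.
    by case=> _ h0; rewrite -[X in X <= _]h0; apply: FZ_mono.
  have attainedP h : S h -> deflation h -> attained `|h k%:Z|%N.
    by move=> Sh dh; apply/asboolP; exists h; split=> //; have := ge0 h dh; lia.
  have ex_v : exists v, attained v.
    exists `|FZ_id k%:Z|%N; apply: attainedP; first exact: alg_id.
    by split.
  case: (ex_minnP ex_v) => v /asboolP[g [Sg [g_le g0] gk]] min_v.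
  exists (FZ_meet m g); split; first exact: alg_meet.
    by split=> [z|] /=; [have := m_le z; lia | rewrite m0 g0; lia].
  move=> h Sh dh i; rewrite ltnS leq_eqVlt => /predU1P[->|ik] /=.
    by have := min_v _ (attainedP h Sh dh); have := ge0 h dh; lia.
  by have := lem h Sh dh i ik; lia.
exists m; split=> // h Sh dh.
apply: (equivariant_le n _ _ 0 n_gt0 (Sn _ Sm) (Sn _ Sh) _) => z /andP[z0 zn].
have zE : `|z|%N%:Z = z by lia.
by rewrite -zE; apply: lem => //; lia.
Qed.

(** * Step functions *)

(** By n-periodicity such a g is determined: it is the step function with value
    u + q n on [x + q n, x + (q + 1) n). *)
Definition has_block (x u : int) : Prop :=
  exists2 g, S g & forall z, x <= z < x + n%:Z -> g z = u.

(** The witness is the least deflation m of S.  It is 0 below its least positive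
    fixed point d, and d is at least n because d turns out to be a period of a:
    otherwise some element of S would be a deflation that is not above m. *)
Lemma has_block_of_aperiodic (a : FZ) : S a ->
  (forall d : nat, (0 < d)%N -> equivariant d%:Z a -> (n <= d)%N) ->
  has_block 0 0.
Proof.
move=> Sa min_n; have [m [Sm [m_le m0] lem]] := least_deflation.
(* The map m o m is again a deflation in S, hence lies above m. *)
have mK z : m (m z) = m z.
  apply/eqP; rewrite eq_le m_le /=.
  apply: (lem (FZ_comp m m)); first exact: alg_comp.
  by split=> [y|] /=; [apply: le_trans (m_le _) | rewrite m0].
have mn : m n%:Z = n%:Z by rewrite -[n%:Z]add0r (Sn _ Sm) m0.
have ex_d : exists d : nat, (0 < d)%N && (m d%:Z == d%:Z).
  by exists n; rewrite n_gt0 mn /=.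
case: (ex_minnP ex_d) => d /andP[d_gt0 /eqP md] min_d.
have a_le (x : int) : a (x + d%:Z) <= a x + d%:Z.
  (* The map mx is the conjugate of m fixing x, and h is the conjugate of f f^r
     that fixes 0 instead of a(x). *)
  have [mx Smx mxE] := alg_shift m x Sm.
  have [f Sf fE] : exists2 f, S f & forall z, f z = a (m (z - x) + x).
    by exists (FZ_comp a mx) => [|z]; [exact: alg_comp | rewrite /= mxE].
  have [h Sh hE] := alg_shift _ (- a x) (alg_comp _ _ Sf (alg_r _ Sf)).
  have fx : f x = a x by rewrite fE subrr m0 add0r.
  have dh : deflation h.
    split=> [z|]; rewrite hE.
      have : f (FZ_r f (z + a x)) <= z + a x by rewrite -FZ_r_ge.
      by rewrite /= opprK; lia.
    have : f (FZ_r f (a x)) = a x.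
      apply/eqP; rewrite eq_le -FZ_r_ge lexx -[X in X <= _]fx.
      by apply: FZ_mono; rewrite FZ_r_ge fx.
    by rewrite /= opprK add0r => ->; rewrite subrr.
  have hd : h d%:Z = d%:Z.
    by apply/eqP; rewrite eq_le dh.1 /= -[X in X <= _]md; apply: lem.
  move: hd; rewrite hE /= fE !opprK.
  (* The fixed point d of h exhibits a x + d as a value of f. *)
  set w := _ - x => wE.
  have aw : a (m w + x) = a x + d%:Z by lia.
  have w_gt0 : 0 < m w.
    case: (ltP 0 (m w)) => // w_le0.
    by have := FZ_mono a _ _ (_ : m w + x <= x); rewrite aw; lia.
  have dw : (d <= `|m w|)%N.
    have mwE : `|m w|%N%:Z = m w by lia.
    by apply: min_d; rewrite mwE mK eqxx; lia.
  by rewrite -aw; apply: FZ_mono; lia.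
(* A strict inequality in a_le would propagate along x, x + d, ..., x + n d and
   contradict a (x + n d) = a x + n d. *)
have ad : equivariant d%:Z a.
  move=> x; apply/eqP; rewrite eq_le a_le /=.
  have iter_le (j : nat) (y : int) : a (y + d%:Z *+ j) <= a y + d%:Z *+ j.
    elim: j y => [|j IH] y; first by rewrite mulr0n !addr0.
    by rewrite mulrS !addrA; apply: le_trans (IH _) _; rewrite lerD2r.
  have := iter_le n.-1 (x + d%:Z).
  rewrite -addrA -mulrS prednK //.
  have -> : d%:Z *+ n = d%:Z * n%:Z by rewrite -mulr_natr natz.
  rewrite (equivariantMz _ _ _ _ (Sn _ Sa)) => ax.
  suff : d%:Z * n%:Z = d%:Z + d%:Z *+ n.-1 by lia.
  by rewrite -mulrS prednK // -mulr_natr natz.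
(* Now n <= d, so a positive value of m below n would be a fixed point smaller
   than d. *)
have nd := min_n d d_gt0 ad.
exists m => // z /andP[z0 zn]; apply/eqP; rewrite eq_le.
have mz0 : 0 <= m z by rewrite -[X in X <= _]m0; apply: FZ_mono.
rewrite mz0 andbT; case: (leP (m z) 0) => // mz_gt0.
have mzE : `|m z|%N%:Z = m z by lia.
by have := min_d `|m z|%N; rewrite mzE mK eqxx; have := m_le z; lia.
Qed.

Lemma has_block_shift (x u k : int) :
  has_block x u -> has_block (x + k) (u + k).
Proof.
case=> g Sg gE; have [h Sh hE] := alg_shift _ k Sg.
by exists h => // z z_in; rewrite hE gE //; lia.
Qed.

Lemma has_block_comp (x u y v : int) :
  has_block x u -> has_block y v -> y <= u < y + n%:Z -> has_block x v.
Proof.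
move=> [g Sg gE] [h Sh hE] u_in.
by exists (FZ_comp h g) => [|z z_in]; [exact: alg_comp | rewrite /= gE // hE].
Qed.

(** The step function jumps from u to u + n at x + n, so for q in (u, u + n] the
    least p with q <= g p is x + n. *)
Lemma has_block_l (x u : int) : has_block x u -> has_block (u + 1) (x + n%:Z).
Proof.
case=> g Sg gE; exists (FZ_l g) => [|q q_in]; first exact: alg_l.
have gx : g x = u by apply: gE; lia.
have gl : g (x + n%:Z - 1) = u by apply: gE; lia.
have gr : g (x + n%:Z) = u + n%:Z by rewrite (Sn _ Sg) gx.
have := FZ_l_le g (x + n%:Z) q; have := FZ_l_le g (x + n%:Z - 1) q.
rewrite gl gr; lia.
Qed.

(** Let b v say that the step function with value v on [0, n) is available.  Up to
    conjugation it suffices to obtain b v for all v.  Composition lets v decrease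
    by any amount, and ^l reflects v to n - 1 - v, so v can also be made large. *)
Lemma has_block_all (x u : int) : (1 < n)%N -> has_block 0 0 -> has_block x u.
Proof.
move=> n_gt1 b00; pose b v := has_block 0 v.
have b_1 : b (- 1).
  (* For n >= 2 the block [-1, n - 1), with value -1, contains 0. *)
  apply: (has_block_comp _ _ (- 1) _ b00); last by lia.
  by rewrite -[- 1]add0r; apply: has_block_shift.
have b_dec v j : b v -> b (v - j%:Z).
  move=> bv; elim: j => [|j IH]; first by rewrite subr0.
  have -> : v - j.+1%:Z = - 1 + (v - j%:Z) by lia.
  apply: (has_block_comp _ _ _ _ IH (has_block_shift _ _ (v - j%:Z) b_1)); lia.
have b_dual v : b v -> b (n%:Z - 1 - v).
  move=> /has_block_l /(@has_block_shift _ _ (- (v + 1))).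
  by rewrite subrr add0r; congr b; lia.
have bu : b (u - x).
  (* Descend to - k, reflect to n - 1 + k >= u - x, and descend again. *)
  pose k := absz (u - x); pose l := absz (n%:Z - 1 + k%:Z - (u - x))%R.
  have -> : u - x = n%:Z - 1 - (0 - k%:Z) - l%:Z by lia.
  by apply/b_dec/b_dual/b_dec.
by have := has_block_shift _ _ x bu; rewrite /b add0r subrK.
Qed.

(** For each x the step function with value f x on [x, x + n) lies below f and
    meets it at x, so the join over one period equals f. *)
Lemma equivariant_in_alg (f : FZ) :
  (forall x u, has_block x u) -> equivariant n%:Z f -> S f.
Proof.
move=> all_b fn.
have minorant (x : int) : exists g, [/\ S g, forall z, g z <= f z & g x = f x].
  have [g Sg gE] := all_b x (f x); exists g; split=> //; last by apply: gE; lia.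
  apply: (equivariant_le n _ _ x n_gt0 (Sn _ Sg) fn _) => z z_in.
  by rewrite gE //; apply: FZ_mono; lia.
have [g [Sg g_le gE]] : exists g, [/\ S g, forall z, g z <= f z &
    forall i : nat, (i < n)%N -> g i%:Z = f i%:Z].
  elim: n => [|k [g [Sg g_le gE]]].
    by have [g [Sg g_le _]] := minorant 0; exists g; split.
  have [h [Sh h_le hE]] := minorant k%:Z.
  exists (FZ_join g h); split=> [|z|i] /=; first exact: alg_join.
    by have := g_le z; have := h_le z; lia.
  rewrite ltnS leq_eqVlt => /predU1P[->|/gE gi].
    by have := g_le k%:Z; rewrite hE; lia.
  by have := h_le i%:Z; lia.
suff -> : f = g by [].
apply/FZ_eqP => z; apply/eqP; rewrite eq_le g_le andbT.
move: z; apply: (equivariant_le n _ _ 0 n_gt0 fn (Sn _ Sg) _) => z z_in.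
have zE : `|z|%N%:Z = z by lia.
by rewrite -zE gE //; lia.
Qed.

End Subalgebra.

(** * Generation *)

Lemma generated_subalgebra (X : set FZ) : is_subalgebra (generated X).
Proof.
split=> [A [[]] //|]; split=> [f g Sf Sg|f Sf].
  by split=> A AX; have [[_ [op _]] _] := AX; have [] := op f g (Sf A AX) (Sg A AX).
by split=> A AX; have [[_ [_ op]] _] := AX; have [] := op f (Sf A AX).
Qed.

Theorem theorem3p18 (n : nat) (hn : (0 < n)%N) (hn1 : n <> 1%N)
    (a : FZ) (ha : FnZ n a) (hper : has_periodicity a n) :
  generated [set a] = FnZ n.
Proof.
have sub : generated [set a] `<=` FnZ n.
  by apply: smallest_sub; [exact: FnZ_subalgebra | move=> _ ->].
apply/seteqP; split=> // f /periodicP fn.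
have algS := generated_subalgebra [set a].
have Sn g : generated [set a] g -> equivariant n%:Z g by move=> /sub/periodicP.
apply: (equivariant_in_alg _ algS n) => // x u.
apply: has_block_all => //; first by lia.
apply: (has_block_of_aperiodic _ algS n hn Sn a) => [A [_]|d d0 /periodicP ad].
  exact.
by case: hper => _ _; apply.
Qed.
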